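(* Let $N \ge 1$ be an integer and let $D$ and $R$ be non-empty open convex subsets of $\mathbb{R}^N$. Let $f : D \to R$ be of class $C^2$, locally strongly convex on $D$, and invertible (i.e. a bijection from $D$ onto $R$), and let $g = (g_1,\dots,g_N) : R \to D$ be its inverse. Suppose that for every $y \in R$ and every $m \in \{1,\dots,N\}$, the gradient $\nabla g_m(y)$ exists (that is, $g_m$ is differentiable at $y$) and $\nabla g_m(y) \in \mathbb{R}^N_{<0}$. Then $g$ is locally strongly convex on $R$.
   Context: $\mathbb{R}^N_{<0} := (-\infty,0)^N$, i.e. the set of vectors all of whose entries are strictly negative. $\|\cdot\|$ denotes the canonical Euclidean norm on $\mathbb{R}^N$. Let $E$ be a non-empty open convex set in $\mathbb{R}^N$. A real-valued function $h : E \to \mathbb{R}$ is strongly convex on a convex subset $C$ of $E$ if there exists a real $\sigma > 0$ such that for all $u, v \in C$ and all $t \in (0,1)$, $$h((1-t)u + tv) \le (1-t)h(u) + t h(v) - \tfrac{1}{2}\sigma t(1-t)\|u-v\|^2 .$$ The function $h$ is locally strongly convex on $E$ if for each $x \in E$ there is an open convex neighborhood $U \subset E$ of $x$ on which $h$ is strongly convex. A vector-valued function $h : E \to \mathbb{R}^N$ is locally strongly convex on $E$ if each of its $N$ component functions is locally strongly convex on $E$. *)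

(* Defs.v *)
From HB Require Import structures.
From mathcomp Require Import all_boot all_order all_algebra.
From mathcomp Require Import boolp classical_sets functions reals topology.
From mathcomp Require Import convex normedtype derive.

Set Implicit Arguments.
Unset Strict Implicit.
Unset Printing Implicit Defensive.

Import Order.TTheory GRing.Theory Num.Theory.
Import numFieldNormedType.Exports.

Local Open Scope classical_set_scope.
Local Open Scope ring_scope.

(* A map E -> R^M on an open set E of R^N is represented by a total function
   on 'rV[R]_N; every notion below only depends on its values on E. *)

(* The norm `|x| that the library puts on 'rV[R]_N is the sup norm: it induces
   the usual topology and derivatives, but strong convexity refers to the
   Euclidean norm. *)
Definition enorm (R : realType) (N : nat) (x : 'rV[R]_N) : R :=
  Num.sqrt (\sum_(i < N) x ord0 i ^+ 2).

Definition strongly_convex_on (R : realType) (N : nat)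
    (C : set 'rV[R]_N) (h : 'rV[R]_N -> R) : Prop :=
  exists2 sigma : R, 0 < sigma &
    forall (u v : 'rV[R]_N) (t : R), C u -> C v -> 0 < t -> t < 1 ->
      h ((1 - t) *: u + t *: v) <=
        (1 - t) * h u + t * h v
        - 2^-1 * sigma * t * (1 - t) * enorm (u - v) ^+ 2.

Definition locally_strongly_convex (R : realType) (N : nat)
    (E : set 'rV[R]_N) (h : 'rV[R]_N -> R) : Prop :=
  forall x : 'rV[R]_N, E x ->
    exists U : set 'rV[R]_N,
      [/\ open U, convex_set (M := 'rV[R]_N) U, U x, U `<=` E
        & strongly_convex_on U h].

Definition locally_strongly_convex_vec (R : realType) (N M : nat)
    (E : set 'rV[R]_N) (h : 'rV[R]_N -> 'rV[R]_M) : Prop :=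
  forall m : 'I_M, locally_strongly_convex E (fun x => h x ord0 m).

(* C^k on the open set E: all iterated partial derivatives of order at most k
   exist and are continuous at every point of E. *)
Fixpoint class_C (R : realType) (N : nat) (W : normedModType R) (k : nat)
    (E : set 'rV[R]_N) (h : 'rV[R]_N -> W) : Prop :=
  (forall x, E x -> {for x, continuous h}) /\
  if k is k'.+1 then
    forall i : 'I_N,
      (forall x, E x -> derivable h x (delta_mx ord0 i)) /\
      class_C k' E (fun x => 'D_(delta_mx ord0 i) h x)
  else True.

Definition gradient (R : realType) (N : nat) (h : 'rV[R]_N -> R)
    (y : 'rV[R]_N) : 'rV[R]_N :=
  \row_(i < N) 'D_(delta_mx ord0 i) (h : 'rV[R]_N -> R^o) y.

Definition neg_orthant (R : realType) (N : nat) : set 'rV[R]_N :=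
  [set x | forall i : 'I_N, x ord0 i < 0].

(* Main.v *)
Require Import Defs.
From mathcomp Require Import all_boot all_order all_algebra.
From mathcomp Require Import boolp classical_sets functions reals topology.
From mathcomp Require Import convex normedtype derive.
From mathcomp Require Import interval_inference ring lra.

(** Fix [y0] in [E], put [x0 = g y0], and let [u], [v] be close to [y0], with
    [w = (1 - t) u + t v] and [x = (1 - t) g u + t g v].  Strong convexity of
    the components of [f] says that [f x] lies below [w] in every coordinate,
    by at least [sigma / 2 * t (1 - t) |g u - g v|^2] in coordinate [m].  All
    partial derivatives of [g_m] being negative, passing from [w] down to [f x]
    makes [g_m] grow by at least a constant times [|f x - w|].  Since
    [g (f x) = x], this says that
      [x_m - g_m w >= const * t (1 - t) |g u - g v|^2],
    and [|g u - g v|] is at least a constant times [|u - v|] because [f] is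
    Lipschitz near [x0].  This is strong convexity of [g_m] near [y0].

    The growth of [g_m] has to be uniform near [y0].  Instead of showing that
    the gradient of [g] is continuous, the proof uses only the gradient at the
    single point [y0], through strict differentiability: a map of class C^1
    satisfies
      [f p - f q = (p - q) A + o(|p - q|)]   as [p] and [q] both tend to [x0],
    with [A] the matrix of its partial derivatives at [x0]
    ([C1_strict_derivative]).  The chain rule applied to [g (f z) = z] shows
    that the matrix [B] of the partial derivatives of [g] at [y0] satisfies
    [A B = 1] ([partials_left_inverse]), so the expansion can be inverted,
      [p - q = (f p - f q) B + o(|f p - f q|)]
    ([strict_derivative_inverse]); and for a displacement [f p - f q] with
    nonpositive coordinates the linear term dominates the error because the
    entries of [B] are negative ([negative_inverse_decrease]). *)

Set Implicit Arguments.
Unset Strict Implicit.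

Import Order.TTheory GRing.Theory Num.Theory.
Import numFieldNormedType.Exports.

Local Open Scope classical_set_scope.
Local Open Scope ring_scope.
Local Open Scope convex_scope.

(** * Sup norm and Euclidean norm on row vectors *)

Lemma coord_le_norm (R : realType) (n : nat) (x : 'rV[R]_n) (i : 'I_n) :
  `|x ord0 i| <= `|x|.
Proof.
rewrite [leRHS]/Num.Def.normr/= mx_normrE.
exact: (le_bigmax _ (fun ij : 'I_1 * 'I_n => `|x ij.1 ij.2|) (ord0, i)).
Qed.

Lemma norm_le_coord (R : realType) (n : nat) (x : 'rV[R]_n) (c : R) :
  0 <= c -> (forall i, `|x ord0 i| <= c) -> `|x| <= c.
Proof.
move=> c0 xc; rewrite [leLHS]/Num.Def.normr/= mx_normrE (bigmax_le _ c0)//= => -[i j] _.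
by rewrite (ord1 i) xc.
Qed.

Lemma norm_lt_coord (R : realType) (n : nat) (x : 'rV[R]_n) (c : R) :
  0 < c -> (forall i, `|x ord0 i| < c) -> `|x| < c.
Proof.
move=> c0 xc; rewrite [ltLHS]/Num.Def.normr/= mx_normrE.
by apply: bigmax_lt => //= -[i j] _; rewrite (ord1 i) xc.
Qed.

Lemma enorm_sqr (R : realType) (n : nat) (x : 'rV[R]_n) :
  enorm x ^+ 2 = \sum_i x ord0 i ^+ 2.
Proof. by rewrite sqr_sqrtr// sumr_ge0// => i _; rewrite sqr_ge0. Qed.

Lemma norm_le_enorm (R : realType) (n : nat) (x : 'rV[R]_n) :
  `|x| ^+ 2 <= enorm x ^+ 2.
Proof.
rewrite ler_pXn2r ?nnegrE ?sqrtr_ge0//.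
apply: norm_le_coord => [|i]; first exact: sqrtr_ge0.
rewrite -sqrtr_sqr ler_wsqrtr// (bigD1 i)//= lerDl.
by rewrite sumr_ge0// => j _; rewrite sqr_ge0.
Qed.

Lemma enorm_le_norm (R : realType) (n : nat) (x : 'rV[R]_n) :
  enorm x ^+ 2 <= n%:R * `|x| ^+ 2.
Proof.
have -> : n%:R * `|x| ^+ 2 = \sum_(i < n) `|x| ^+ 2.
  by rewrite sumr_const card_ord mulr_natl.
rewrite enorm_sqr.
by apply: ler_sum => i _; rewrite -real_normK ?num_real// lerXn2r ?nnegrE// coord_le_norm.
Qed.

Lemma in_ballE (R : realType) (n : nat) (x y : 'rV[R]_n) (r : R) :
  ball x r y <-> `|x - y| < r.
Proof. by rewrite -ball_normE. Qed.

Lemma ball_convex_comb (R : realType) (n : nat) (x u v : 'rV[R]_n) (r t : R) :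
  ball x r u -> ball x r v -> 0 <= t -> t <= 1 ->
  ball x r ((1 - t) *: u + t *: v).
Proof.
move=> /in_ballE xu /in_ballE xv t0 t1; apply/in_ballE.
have -> : x - ((1 - t) *: u + t *: v) = (1 - t) *: (x - u) + t *: (x - v).
  by apply/matrixP => i j; rewrite !mxE; ring.
apply: le_lt_trans (ler_normD _ _) _.
rewrite !normrZ (ger0_norm t0) ger0_norm ?subr_ge0//.
move: t0; rewrite le_eqVlt => /predU1P[<-|t0]; first by rewrite subr0 mul1r mul0r addr0.
have : t * `|x - v| < t * r by rewrite ltr_pM2l.
have : (1 - t) * `|x - u| <= (1 - t) * r by rewrite ler_wpM2l ?subr_ge0// ltW.
lra.
Qed.

Lemma convex_ball (R : realType) (n : nat) (x : 'rV[R]_n) (r : R) :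
  convex_set (M := 'rV[R]_n) (ball x r).
Proof.
move=> u v l; rewrite !inE => xu xv.
have -> : u <| l |> v = (1 - (1 - l%:num)) *: (u : 'rV[R]_n) + (1 - l%:num) *: (v : 'rV[R]_n).
  by rewrite subKr.
by apply: ball_convex_comb => //; rewrite ?subr_ge0 ?gerBl ?le1 ?ge0.
Qed.

Lemma mulmx_row_bounded (R : realType) (n k : nat) (M : 'M[R]_(n, k)) :
  exists2 K : R, 0 < K & forall v : 'rV[R]_n, `|v *m M| <= K * `|v|.
Proof.
exists (1 + \sum_i \sum_j `|M i j|).
  by rewrite ltr_pwDl// sumr_ge0// => i _; rewrite sumr_ge0.
move=> v.
have K0 : 0 <= \sum_i \sum_j `|M i j| by rewrite sumr_ge0// => i _; rewrite sumr_ge0.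
apply: norm_le_coord => [|j]; first by rewrite mulr_ge0// addr_ge0.
rewrite mxE (le_trans (ler_norm_sum _ _ _))//.
rewrite mulrDl mul1r ler_wpDl// mulr_suml ler_sum// => i _.
rewrite normrM mulrC ler_pM ?coord_le_norm//.
by rewrite (bigD1 j)//= lerDl sumr_ge0.
Qed.

(** * Strict differentiability of maps of class C^1 *)

(** The mean value theorem on a segment [s *: e + w], in the form that compares
    an increment with a constant slope.  The endpoints are parametrized by
    [a] and [b] in either order, as coordinate increments have no fixed sign. *)
Lemma increment_along_direction (R : realType) (V : normedModType R)
    (F : V -> R) (e w : V) (alpha eps a b : R) :
  (forall s, Num.min a b <= s -> s <= Num.max a b ->
     derivable (F : V -> R^o) (s *: e + w) e /\
     `|'D_e (F : V -> R^o) (s *: e + w) - alpha| <= eps) ->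
  `|F (b *: e + w) - F (a *: e + w) - (b - a) * alpha| <= eps * `|b - a|.
Proof.
wlog ab : a b / a <= b.
  move=> W H; have [ab|/ltW ba] := leP a b; first exact: W.
  have -> : F (b *: e + w) - F (a *: e + w) - (b - a) * alpha
    = - (F (a *: e + w) - F (b *: e + w) - (a - b) * alpha) by ring.
  rewrite normrN (distrC b).
  by apply: W => // s; rewrite minC maxC; apply: H.
rewrite min_l// max_r// => H.
pose phi (s : R) : R^o := F (s *: e + w).
have dphi s : a <= s -> s <= b -> is_derive s 1 phi ('D_e (F : V -> R^o) (s *: e + w)).
  move=> sa sb; have [dF _] := H s sa sb.
  have E : (fun h : R => h^-1 *: (phi (h *: 1 + s) - phi s)) =
    (fun h => h^-1 *: ((F : V -> R^o) (h *: e + (s *: e + w)) - F (s *: e + w))).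
    by apply/funext => h; rewrite /phi addrA -scalerDl [h%:A]mulr1.
  by apply: DeriveDef; rewrite /derivable /derive /= E.
have [||c] := @MVT_segment R phi (fun s => 'D_e (F : V -> R^o) (s *: e + w)) a b ab.
- by move=> s; rewrite in_itv/= => /andP[/ltW sa /ltW sb]; exact: dphi.
- apply: derivable_within_continuous => s; rewrite in_itv/= => /andP[sa sb].
  by have [] := dphi s sa sb.
rewrite in_itv/= => /andP[ca cb]; rewrite /phi => ->.
rewrite [X in _ - X]mulrC -mulrBl normrM ler_wpM2r//.
by have [] := H c ca cb.
Qed.

(** Moving from [q] to [p] one coordinate at a time stays in the ball, because
    balls of the sup norm are boxes; each move is a one-variable increment. *)
Lemma box_increment (R : realType) (n : nat) (F : 'rV[R]_n -> R)
    (alpha : 'I_n -> R) (x : 'rV[R]_n) (r eps : R) :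
  (forall z i, ball x r z ->
     derivable (F : 'rV[R]_n -> R^o) z (delta_mx ord0 i) /\
     `|'D_(delta_mx ord0 i) (F : 'rV[R]_n -> R^o) z - alpha i| <= eps) ->
  forall p q, ball x r p -> ball x r q ->
    `|F p - F q - \sum_i (p - q) ord0 i * alpha i| <= n%:R * eps * `|p - q|.
Proof.
move=> H p q xp xq.
have r0 : 0 < r by move/in_ballE : xp; apply: le_lt_trans.
pose z k : 'rV[R]_n := \row_(j < n) (if (j < k)%N then p ord0 j else q ord0 j).
have zn : z n = p by apply/rowP => j; rewrite mxE ltn_ord.
have z0 : z 0%N = q by apply/rowP => j; rewrite mxE ltn0.
have -> : F p - F q = \sum_(i < n) (F (z i.+1) - F (z i)).
  by rewrite -zn -z0 -(telescope_sumr (fun k => F (z k)))// big_mkord.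
rewrite -sumrB (le_trans (ler_norm_sum _ _ _))//.
have -> : n%:R * eps * `|p - q| = \sum_(i < n) eps * `|p - q|.
  by rewrite sumr_const card_ord -mulrA mulr_natl.
apply: ler_sum => i _.
(* the base point has coordinate [i] cleared, so that the parameter of the line
   is the value of that coordinate *)
pose w : 'rV[R]_n := \row_(j < n) (if j == i then 0 else z i ord0 j).
have zE s : s *: delta_mx ord0 i + w =
    \row_(j < n) (if j == i then s else z i ord0 j).
  apply/rowP => j; rewrite !mxE eqxx/=.
  by case: eqP => _; rewrite ?mulr1 ?mulr0 ?addr0 ?add0r.
have zSE : z i.+1 = p ord0 i *: delta_mx ord0 i + w.
  rewrite zE; apply/rowP => j; rewrite !mxE ltnS leq_eqVlt.
  by rewrite -val_eqE /=; case: eqVneq => [/val_inj->|].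
have ziE : z i = q ord0 i *: delta_mx ord0 i + w.
  rewrite zE; apply/rowP => j; rewrite !mxE.
  by case: (eqVneq j i) => [->|ji]; rewrite ?ltnn.
rewrite zSE ziE !mxE.
apply: (le_trans (increment_along_direction (alpha := alpha i) (eps := eps) _)); last first.
  rewrite ler_wpM2l//; last by have := coord_le_norm (p - q) i; rewrite !mxE.
  have [_] := H x i (ballxx x r0); exact: le_trans.
move=> s sm sM; apply: H; apply/in_ballE/norm_lt_coord => // j; rewrite zE !mxE.
have pr k : `|x ord0 k - p ord0 k| < r.
  by apply: le_lt_trans ((in_ballE _ _ _).1 xp); have := coord_le_norm (x - p) k; rewrite !mxE.
have qr k : `|x ord0 k - q ord0 k| < r.
  by apply: le_lt_trans ((in_ballE _ _ _).1 xq); have := coord_le_norm (x - q) k; rewrite !mxE.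
case: eqP => [->|_]; last by case: ifP.
have := pr i; have := qr i; rewrite !ltr_distlC => /andP[q1 q2] /andP[p1 p2].
have [sq sp] : s < x ord0 i + r /\ x ord0 i - r < s.
  by split; [rewrite (le_lt_trans sM)// gt_max q2 p2|rewrite (lt_le_trans _ sm)// lt_min q1 p1].
by rewrite sp sq.
Qed.

(** Strict (Peano, or strong) differentiability: both endpoints of the increment
    vary.  As vectors are rows, [A] acts on the right. *)
Definition strict_derivative_at (R : realType) (n k : nat)
    (f : 'rV[R]_n -> 'rV[R]_k) (A : 'M[R]_(n, k)) (x : 'rV[R]_n) : Prop :=
  forall eps : R, 0 < eps -> exists2 r : R, 0 < r &
    forall p q, ball x r p -> ball x r q ->
      `|f p - f q - (p - q) *m A| <= eps * `|p - q|.

(** The transpose of the usual Jacobian matrix, defined from directional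
    derivatives so as not to presuppose differentiability. *)
Definition partials (R : realType) (n k : nat) (f : 'rV[R]_n -> 'rV[R]_k)
    (x : 'rV[R]_n) : 'M[R]_(n, k) :=
  \matrix_(i < n) 'D_(delta_mx ord0 i) f x.

(** Subtracting the linear map [partials f x] leaves a map whose partial
    derivatives are small near [x], so that its increments are small. *)
Lemma C1_strict_derivative (R : realType) (n k : nat) (D : set 'rV[R]_n)
    (f : 'rV[R]_n -> 'rV[R]_k) (x : 'rV[R]_n) :
  open D -> class_C 1 D f -> D x -> strict_derivative_at f (partials f x) x.
Proof.
move=> Dopen [_ fC1] Dx eps eps0.
(* the [n] coordinates share the error; [n.+1] avoids a division by zero *)
pose e' := eps / n.+1%:R.
have e'0 : 0 < e' by rewrite divr_gt0.
have : \forall z \near x, D z /\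
   forall i, `|'D_(delta_mx ord0 i) f z - 'D_(delta_mx ord0 i) f x| <= e'.
  apply: filterI; first exact: open_nbhs_nbhs.
  apply: (@filter_forall _ _ (fun i z =>
    `|'D_(delta_mx ord0 i) f z - 'D_(delta_mx ord0 i) f x| <= e') (nbhs x)) => i.
  have [_ [C _]] := fC1 i.
  have /cvgrPdist_le/(_ _ e'0) := C x Dx.
  by apply: filterS => z; rewrite distrC.
move=> /nbhs_ballP[r /= r0 rD]; exists r => // p q xp xq.
apply: norm_le_coord => [|j]; first by rewrite mulr_ge0// ltW.
have := @box_increment R n (fun z => f z ord0 j) (fun i => partials f x i j) x r e' _ p q xp xq.
rewrite !mxE => H; apply: le_trans (H _) _.
  move=> z i /rD[Dz /(_ i) zi].
  have dz : derivable f z (delta_mx ord0 i) by have [+ _] := fC1 i; apply.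
  split; first by move/derivable_mxP : dz => /(_ ord0 j).
  apply: le_trans zi; apply: le_trans (coord_le_norm _ j).
  by rewrite !mxE (derive_mx dz) !mxE.
by rewrite ler_wpM2r// /e' mulrCA ger_pMr// ler_pdivrMr// mul1r ler_nat.
Qed.

Lemma strict_derivative_lipschitz (R : realType) (n k : nat)
    (f : 'rV[R]_n -> 'rV[R]_k) (A : 'M[R]_(n, k)) (x : 'rV[R]_n) :
  strict_derivative_at f A x -> exists2 L : R, 0 < L & exists2 r : R, 0 < r &
    forall p q, ball x r p -> ball x r q -> `|f p - f q| <= L * `|p - q|.
Proof.
move=> /(_ _ ltr01)[r r0 fA]; have [K K0 AK] := mulmx_row_bounded A.
exists (1 + K); first by rewrite addr_gt0.
exists r => // p q xp xq.
rewrite -[f p - f q](subrK ((p - q) *m A)) (le_trans (ler_normD _ _))//.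
by rewrite mulrDl lerD// fA.
Qed.

(** * Inverse maps with negative gradients *)

(** The expansion of an inverse map, phrased without naming the inverse:
    multiplying the expansion of [f] by [B] gives an error of order [|p - q|],
    and absorbing part of it shows that [|p - q|] is at most a constant times
    [|f p - f q|]. *)
Lemma strict_derivative_inverse (R : realType) (n : nat)
    (f : 'rV[R]_n -> 'rV[R]_n) (A B : 'M[R]_n) (x : 'rV[R]_n) :
  strict_derivative_at f A x -> A *m B = 1%:M ->
  forall eps : R, 0 < eps -> exists2 r : R, 0 < r &
    forall p q, ball x r p -> ball x r q ->
      `|p - q - (f p - f q) *m B| <= eps * `|f p - f q|.
Proof.
move=> fA AB eps eps0; have [K K0 BK] := mulmx_row_bounded B.
(* the first bound lets the error be absorbed into [|p - q|], the second makes
   what remains at most [eps]; the factor 2 is the cost of the absorption *)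
pose e1 := Num.min (2^-1 / K) (eps / (2 * K ^+ 2)).
have e10 : 0 < e1 by rewrite lt_min !divr_gt0 ?mulr_gt0 ?exprn_gt0.
have Ke1 : K * e1 <= 2^-1.
  by rewrite mulrC -ler_pdivlMr// ge_min lexx.
have Ke2 : K * e1 * (2 * K) <= eps.
  rewrite (_ : K * e1 * (2 * K) = e1 * (2 * K ^+ 2)); last by ring.
  by rewrite -ler_pdivlMr ?mulr_gt0 ?exprn_gt0// ge_min lexx orbT.
have [r r0 fr] := fA _ e10; exists r => // p q xp xq.
have err : `|p - q - (f p - f q) *m B| <= K * e1 * `|p - q|.
  have -> : p - q - (f p - f q) *m B = - ((f p - f q - (p - q) *m A) *m B).
    by rewrite [in RHS]mulmxBl -mulmxA AB mulmx1 opprB.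
  by rewrite normrN (le_trans (BK _))// -mulrA ler_pM2l// fr.
have pqf : `|p - q| <= 2 * K * `|f p - f q|.
  have : `|p - q| <= K * e1 * `|p - q| + K * `|f p - f q|.
    rewrite -[X in `|X| <= _](subrK ((f p - f q) *m B)).
    by rewrite (le_trans (ler_normD _ _))// lerD.
  have : K * e1 * `|p - q| <= 2^-1 * `|p - q| by rewrite ler_wpM2r.
  lra.
apply: (le_trans err).
apply: (@le_trans _ _ (K * e1 * (2 * K * `|f p - f q|))).
  by rewrite ler_wpM2l// ltW// mulr_gt0.
by rewrite mulrA ler_wpM2r.
Qed.

(** The chain rule along the curves [s |-> f (s *: e_i + x)], where [e_i] is
    the [i]-th basis vector: [g] maps this curve back to the line
    [s *: e_i + x].  Only the directional derivatives of [f] enter, since a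
    curve is differentiable as soon as it is derivable. *)
Lemma partials_left_inverse (R : realType) (n : nat)
    (f g : 'rV[R]_n -> 'rV[R]_n) (x : 'rV[R]_n) :
  (forall i, derivable f x (delta_mx ord0 i)) ->
  (forall m, differentiable (fun z => g z ord0 m : R^o) (f x)) ->
  (\forall z \near x, g (f z) = z) ->
  partials f x *m
    (\matrix_(i, m) 'D_(delta_mx ord0 i) (fun z => g z ord0 m : R^o) (f x)) = 1%:M.
Proof.
move=> fd gd gf; apply/matrixP => i m; rewrite !mxE.
pose e : 'rV[R]_n := delta_mx ord0 i.
pose G (z : 'rV[R]_n) : R^o := g z ord0 m.
have xe : 0 *: e + x = x by rewrite scale0r add0r.
pose c (s : R) := f (s *: e + x).
have cE : (fun h : R => h^-1 *: (c (h *: 1 + 0) - c 0)) =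
    (fun h => h^-1 *: (f (h *: e + x) - f x)).
  by apply/funext => h; rewrite /c addr0 [h%:A]mulr1 xe.
have dc : derivable c 0 1 by rewrite /derivable /= cE; exact: fd.
have Dc : 'D_1 c 0 = 'D_e f x by rewrite /derive /= cE.
have c0 : c 0 = f x by rewrite /c xe.
have dG : differentiable G (c 0) by rewrite c0; exact: gd.
have dcd : differentiable c 0 by exact/derivable1_diffP.
have lhs : 'D_1 (G \o c) 0 = 'd G (f x) ('D_e f x).
  rewrite deriveE; last exact: differentiable_comp.
  by rewrite (diff_comp dcd dG) /comp -(deriveE _ dcd) Dc c0.
have rhs : 'D_1 (G \o c) 0 = (i == m)%:R.
  have -> : 'D_1 (G \o c) 0 = 'D_1 (fun s : R => s * e ord0 m + x ord0 m : R^o) 0.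
    apply: near_eq_derive; rewrite /G /c /=.
    have cv : s *: e + x @[s --> (0 : R)] --> x.
      rewrite -[X in _ --> X]xe; apply: cvgD; last exact: cvg_cst.
      by apply: cvgZr_tmp; exact: cvg_id.
    have gfe : \forall s \near (0 : R), g (f (s *: e + x)) = s *: e + x.
      exact: (cv _ gf).
    by move: gfe; apply: filterS => s /= ->; rewrite !mxE.
  rewrite deriveD// derive_cst addr0 deriveMr// derive_id mulr1.
  by rewrite /e mxE eqxx/= eq_sym.
rewrite -rhs lhs.
have -> : 'D_e f x = \sum_j partials f x i j *: delta_mx ord0 j.
  by rewrite [LHS]row_sum_delta; apply: eq_bigr => j _; rewrite mxE.
rewrite linear_sum.
under eq_bigr => j _ do rewrite [X in _ * X]mxE (deriveE _ (gd m)).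
by under [RHS]eq_bigr => j _ do rewrite linearZ.
Qed.

Lemma finite_neg_bound (R : realType) (n : nat) (a : 'I_n -> R) :
  (forall i, a i < 0) -> exists2 d : R, 0 < d & forall i, a i <= - d.
Proof.
move=> a0.
(* the default value 1 keeps the minimum positive over an empty index type *)
exists (\big[Num.min/1]_i (- a i)).
  by apply: lt_bigmin => // i _; rewrite oppr_gt0.
by move=> i; rewrite lerNr; exact: bigmin_le_cond.
Qed.

(** All the terms [v_i B_im] have the same sign, so the largest coordinate of
    [v] alone accounts for the bound. *)
Lemma negative_mx_monotone (R : realType) (n : nat) (B : 'M[R]_n) (m : 'I_n)
    (delta : R) (v : 'rV[R]_n) :
  0 < delta -> (forall i, B i m <= - delta) -> (forall i, v ord0 i <= 0) ->
  delta * `|v| <= (v *m B) ord0 m.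
Proof.
move=> d0 Bd v0.
have term i : delta * `|v ord0 i| <= v ord0 i * B i m.
  by rewrite ler0_norm//; have := Bd i; have := v0 i; nra.
have s0 : 0 <= (v *m B) ord0 m.
  by rewrite mxE sumr_ge0// => i _; rewrite (le_trans _ (term i))// mulr_ge0// ltW.
rewrite mulrC -ler_pdivlMr//; apply: norm_le_coord => [|i]; first by rewrite divr_ge0// ltW.
rewrite ler_pdivlMr// mulrC (le_trans (term i))// mxE (bigD1 i)//= lerDl.
by rewrite sumr_ge0// => j _; rewrite (le_trans _ (term j))// mulr_ge0// ltW.
Qed.

(** A uniform form of the fact that an inverse with negative gradients is
    decreasing.  Half of a lower bound for the [- B i m] is kept as [d]; the
    other half absorbs the nonlinear error. *)
Lemma negative_inverse_decrease (R : realType) (n : nat)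
    (f : 'rV[R]_n -> 'rV[R]_n) (A B : 'M[R]_n) (x : 'rV[R]_n) (m : 'I_n) :
  strict_derivative_at f A x -> A *m B = 1%:M -> (forall i, B i m < 0) ->
  exists2 d : R, 0 < d & exists2 r : R, 0 < r &
    forall p q, ball x r p -> ball x r q ->
      (forall i, f p ord0 i <= f q ord0 i) ->
      d * `|f p - f q| <= p ord0 m - q ord0 m.
Proof.
move=> fA AB /finite_neg_bound[d d0 Bd]; exists (d / 2); first by rewrite divr_gt0.
have [r r0 finv] := strict_derivative_inverse fA AB (divr_gt0 d0 (ltr0Sn R 1)).
exists r => // p q xp xq fpq.
have lin : d * `|f p - f q| <= ((f p - f q) *m B) ord0 m.
  apply: negative_mx_monotone => // i.
  by rewrite !mxE subr_le0.
have := le_trans (coord_le_norm _ m) (finv p q xp xq).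
rewrite mxE [X in _ + X]mxE [(p - q) _ _]mxE [(- q) _ _]mxE.
rewrite ler_norml => /andP[lo _]; lra.
Qed.

(** * Strong convexity *)

Lemma strongly_convex_on_convex (R : realType) (n : nat) (C : set 'rV[R]_n)
    (h : 'rV[R]_n -> R) (p q : 'rV[R]_n) (t : R) :
  strongly_convex_on C h -> C p -> C q -> 0 < t -> t < 1 ->
  h ((1 - t) *: p + t *: q) <= (1 - t) * h p + t * h q.
Proof.
move=> [s s0 H] Cp Cq t0 t1; apply: le_trans (H _ _ _ Cp Cq t0 t1) _.
by rewrite gerBl mulr_ge0 ?sqr_ge0// !mulr_ge0 ?subr_ge0// ltW.
Qed.

Lemma locally_strongly_convex_vec_ball (R : realType) (n k : nat)
    (D : set 'rV[R]_n) (f : 'rV[R]_n -> 'rV[R]_k) (x : 'rV[R]_n) :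
  locally_strongly_convex_vec D f -> D x ->
  exists2 r : R, 0 < r &
    forall i, strongly_convex_on (ball x r) (fun z => f z ord0 i).
Proof.
move=> fD Dx.
have : \forall z \near x, forall i, sval (cid (fD i x Dx)) z.
  apply: (@filter_forall _ _ (fun i z => sval (cid (fD i x Dx)) z) (nbhs x)) => i.
  by case: cid => U /= [Uo _ Ux _ _]; exact: open_nbhs_nbhs.
move=> /nbhs_ballP[r /= r0 rU]; exists r => // i.
have [_ _ _ _ [s s0 H]] := svalP (cid (fD i x Dx)).
by exists s => // p q t /rU/(_ i) Up /rU/(_ i) Uq; exact: H.
Qed.

Theorem theorem1 (R : realType) (N : nat) (hN : (1 <= N)%N)
    (D E : set 'rV[R]_N)
    (D_nonempty : D !=set0) (D_open : open D)
    (D_convex : convex_set (M := 'rV[R]_N) D)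
    (E_nonempty : E !=set0) (E_open : open E)
    (E_convex : convex_set (M := 'rV[R]_N) E)
    (f g : 'rV[R]_N -> 'rV[R]_N)
    (f_bij : set_bij D E f)
    (f_C2 : class_C 2 D f)
    (f_lsc : locally_strongly_convex_vec D f)
    (gK : {in D, cancel f g}) (fK : {in E, cancel g f})
    (g_diff : forall (y : 'rV[R]_N) (m : 'I_N), E y ->
       differentiable (fun z : 'rV[R]_N => g z ord0 m : R^o) y)
    (g_grad : forall (y : 'rV[R]_N) (m : 'I_N), E y ->
       neg_orthant (gradient (fun z : 'rV[R]_N => g z ord0 m) y)) :
  locally_strongly_convex_vec E g.
Proof.
move=> m y0 Ey0.
have [_ _ fsurj] := f_bij.
have gED y : E y -> D (g y) by move=> /fsurj[x Dx <-]; rewrite gK ?inE.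
have gfK x : D x -> g (f x) = x by move=> Dx; rewrite gK ?inE.
have fgK y : E y -> f (g y) = y by move=> Ey; rewrite fK ?inE.
pose x0 := g y0; have Dx0 : D x0 := gED _ Ey0.
have fx0 : f x0 = y0 := fgK _ Ey0.
have f_C1 : class_C 1 D f.
  by case: f_C2 => fc fd; split=> // i; have [? []] := fd i.
have fA := C1_strict_derivative D_open f_C1 Dx0.
pose B : 'M[R]_N :=
  \matrix_(i, j) 'D_(delta_mx ord0 i) (fun z => g z ord0 j : R^o) (f x0).
have AB : partials f x0 *m B = 1%:M.
  apply: partials_left_inverse.
  - by move=> i; have [_ /(_ i)[+ _]] := f_C1; apply.
  - by move=> j; rewrite fx0; exact: g_diff.
  - by apply: filterS (open_nbhs_nbhs (conj D_open Dx0)) => z; exact: gfK.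
have B_neg i : B i m < 0 by have := @g_grad y0 m Ey0 i; rewrite !mxE fx0.
have [delta delta0 [r2 r20 decr]] := negative_inverse_decrease fA AB B_neg.
have [L L0 [r1 r10 fL]] := strict_derivative_lipschitz fA.
have [r3 r30 fcvx] := locally_strongly_convex_vec_ball f_lsc Dx0.
have [sigma sigma0 fm] := fcvx m.
pose r := Num.min r1 (Num.min r2 r3).
have r0 : 0 < r by rewrite !lt_min r10 r20 r30.
have xr z : ball x0 r z -> [/\ ball x0 r1 z, ball x0 r2 z & ball x0 r3 z].
  move=> /in_ballE; rewrite !lt_min => /and3P[? ? ?].
  by split; apply/in_ballE.
have : \forall y \near y0, E y /\ ball x0 r (g y).
  apply: filterI; first exact: open_nbhs_nbhs.
  have : \forall y \near y0, forall i, `|g y0 ord0 i - g y ord0 i| < r.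
    apply: (@filter_forall _ _ (fun i y => `|g y0 ord0 i - g y ord0 i| < r) (nbhs y0)) => i.
    have /cvgrPdist_lt/(_ _ r0) := differentiable_continuous (@g_diff y0 i Ey0).
    exact.
  apply: filterS => y H; apply/in_ballE/norm_lt_coord => // i.
  by rewrite !mxE.
move=> /nbhs_ballP[s /= s0 sE].
exists (ball y0 s); split.
- exact: ball_open.
- exact: convex_ball.
- exact: ballxx.
- by move=> y /sE[].
have NL0 : 0 < N%:R * L ^+ 2 by rewrite mulr_gt0 ?ltr0n// exprn_gt0.
(* [N] is the cost of bounding the Euclidean norm by the sup norm, and
   [L ^+ 2] of passing from [|u - v|] to [|g u - g v|] *)
exists (delta * sigma / (N%:R * L ^+ 2)).
  by rewrite divr_gt0 ?mulr_gt0// ltr0n.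
move=> u v t yu yv t0 t1.
have t1' : 0 < 1 - t by rewrite subr_gt0.
have yw := ball_convex_comb yu yv (ltW t0) (ltW t1).
set w := (1 - t) *: u + t *: v in yw *.
have [Eu xp] := sE _ yu; have [Ev xq] := sE _ yv; have [Ew xz] := sE _ yw.
set p := g u in xp *; set q := g v in xq *; set z := g w in xz *.
have xx := ball_convex_comb xp xq (ltW t0) (ltW t1).
set x := (1 - t) *: p + t *: q in xx *.
have [p1 _ p3] := xr _ xp; have [q1 _ q3] := xr _ xq.
have [_ z2 _] := xr _ xz; have [_ x2 _] := xr _ xx.
have fp : f p = u := fgK _ Eu.
have fq : f q = v := fgK _ Ev.
have fz : f z = w := fgK _ Ew.
pose c := 2^-1 * sigma * t * (1 - t) * enorm (p - q) ^+ 2.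
have fxw i : f x ord0 i <= f z ord0 i.
  have := strongly_convex_on_convex (fcvx i) p3 q3 t0 t1.
  by rewrite fp fq fz !mxE.
have cfx : c <= `|f x - f z|.
  have := fm _ _ _ p3 q3 t0 t1; rewrite fp fq -/x -/c => H.
  apply: le_trans (coord_le_norm _ m).
  by rewrite fz ler0_norm !mxE ?subr_le0; have := fxw m; rewrite fz !mxE; lra.
have gap : delta * c <= x ord0 m - z ord0 m.
  by apply: le_trans (decr _ _ x2 z2 fxw); rewrite ler_pM2l.
have euv : enorm (u - v) ^+ 2 <= N%:R * L ^+ 2 * enorm (p - q) ^+ 2.
  apply: le_trans (enorm_le_norm _) _.
  rewrite -mulrA ler_wpM2l// (le_trans (_ : _ <= (L * `|p - q|) ^+ 2))//.
    by rewrite lerXn2r ?nnegrE ?mulr_ge0 ?(ltW L0)// -fp -fq fL.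
  by rewrite exprMn ler_wpM2l ?norm_le_enorm// exprn_ge0// ltW.
have fin : 2^-1 * (delta * sigma / (N%:R * L ^+ 2)) * t * (1 - t) * enorm (u - v) ^+ 2
    <= delta * c.
  have -> : delta * c = 2^-1 * (delta * sigma / (N%:R * L ^+ 2)) * t * (1 - t)
      * (N%:R * L ^+ 2 * enorm (p - q) ^+ 2).
    rewrite /c; field.
    by rewrite (gt_eqF L0) pnatr_eq0 -lt0n hN.
  rewrite ler_wpM2l//.
  by rewrite !mulr_ge0 ?invr_ge0 ?mulr_ge0 ?sqr_ge0// ltW.
move: gap; rewrite {1}/x !mxE => gap.
lra.
Qed.
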